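(* Let $H$ be a connected hypergraph with a minimal edge cut $F$, and let $\{ V_i: i \in I\}$ be a partition of $V(H)$ such that each $V_i$ is a union of the vertex sets of connected components of $H \backslash F$. Then (i) $H$ has an Euler family if and only if for some edge cut assignment $\alpha: F \to I^{[2]}$, each connected component of $H^{\alpha}$ has an Euler family; and (ii) $H$ has an Euler tour if and only if for some edge cut assignment $\alpha: F \to I^{[2]}$, the hypergraph $H^{\alpha}$ has a unique non-empty connected component, and this component has an Euler tour.
   Context: A hypergraph $H=(V,E)$: non-empty finite vertex set $V$ and finite multiset $E$ of subsets of $V$ (edges). Distinct $u,v$ are adjacent via $e$ if $u,v\in e$. A walk is $v_0e_1v_1\ldots e_kv_k$ with $v_{i-1},v_i$ adjacent via $e_i$; anchors are $v_0,\dots,v_k$; closed if $v_0=v_k$, $k\ge2$; trail if edges are pairwise distinct. Connected components are maximal connected subhypergraphs without empty edges; a hypergraph is empty if it has no edges. An Euler tour is a closed trail traversing every edge; an Euler family is a set of pairwise edge-disjoint and anchor-disjoint closed trails jointly traversing every edge. For $F\subseteq E$, $H\backslash F=(V,E-F)$. An edge cut is a set $[S,V-S]_H=\{e\in E: e\cap S\ne\emptyset\ne e\cap(V-S)\}$ for non-empty proper $S\subset V$; minimal if it properly contains no other edge cut. For finite $I$, $I^{[2]}=\{ij:i,j\in I\}$ is the set of unordered pairs with repetition allowed. An edge cut assignment is a map $\alpha:F\to I^{[2]}$ such that $\alpha(f)=ij$, $i\ne j$, implies $f\cap V_i\ne\emptyset\ne f\cap V_j$, and $\alpha(f)=ii$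 implies $|f\cap V_i|\ge2$. For $e\in E$: $e^\alpha=e\cap(V_i\cup V_j)$ if $e\in F$, $\alpha(e)=ij$; $e^\alpha=e$ if $e\notin F$. $H^\alpha$ has vertex set $V(H)$ and edge multiset $\{\!\{e^\alpha:e\in E(H)\}\!\}$.
   Formalization: H is assumed to have no empty edges; with an empty edge the statement fails, e.g. V={u,v} with edges {u,v}, {u,v}, ∅, where the only component of H^α has an Euler tour but H has neither an Euler tour nor an Euler family. *)

(* Defs.v *)
From HB Require Import structures.
From mathcomp Require Import all_boot.
Set Implicit Arguments.
Unset Strict Implicit.
Unset Printing Implicit Defensive.

(** The edge multiset is a family of subsets of the vertex set, indexed by a
    finite set [eset] of labels: parallel edges carry different labels.  The
    value of [ends] outside [eset] is fixed to [set0], so that Leibniz equality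
    of hypergraphs is equality of vertex sets and of edge families. *)
Record hypergraph (T L : finType) := Hypergraph {
  vset : {set T};
  eset : {set L};
  ends : {ffun L -> {set T}};
  vset_neq0 : vset != set0;
  ends_sub : [forall e, ends e \subset vset];
  ends_out : [forall (e | e \notin eset), ends e == set0] }.

Section Walks.
Variables T L : finType.
Implicit Types (H C D : hypergraph T L) (S : {set T}) (F : {set L}).

Definition adjacent_via H (e : L) (u v : T) : bool :=
  [&& e \in eset H, u != v, u \in ends H e & v \in ends H e].

(** The walk v0 e1 v1 ... ek vk is stored as (v0, [:: (e1, v1); ...; (ek, vk)]). *)
Definition walk : Type := (T * seq (L * T))%type.

Fixpoint is_walk_from H (v : T) (s : seq (L * T)) : bool :=
  if s is (e, u) :: s' then adjacent_via H e v u && is_walk_from H u s'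
  else v \in vset H.

Definition is_walk H (w : walk) : bool := is_walk_from H w.1 w.2.

Definition walk_edges (w : walk) : seq L := [seq p.1 | p <- w.2].
Definition anchors (w : walk) : seq T := w.1 :: [seq p.2 | p <- w.2].
Definition walk_end (w : walk) : T := last w.1 [seq p.2 | p <- w.2].

Definition closed_walk H (w : walk) : bool :=
  [&& is_walk H w, walk_end w == w.1 & 2 <= size w.2].

Definition closed_trail H (w : walk) : bool :=
  closed_walk H w && uniq (walk_edges w).

Definition euler_tour H (w : walk) : Prop :=
  closed_trail H w /\ forall e, e \in eset H -> e \in walk_edges w.

Definition has_euler_tour H : Prop := exists w, euler_tour H w.

Definition edge_disjoint (w w' : walk) : bool :=
  ~~ has (mem (walk_edges w)) (walk_edges w').
Definition anchor_disjoint (w w' : walk) : bool :=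
  ~~ has (mem (anchors w)) (anchors w').

(** The family may be empty, as it must be when [H] has no edges; it has no
    repetitions, since a closed trail is not edge-disjoint from itself. *)
Definition euler_family H (ws : seq walk) : Prop :=
  [/\ all (closed_trail H) ws,
      pairwise (fun w w' => edge_disjoint w w' && anchor_disjoint w w') ws
    & forall e, e \in eset H -> exists2 w, w \in ws & e \in walk_edges w].

Definition has_euler_family H : Prop := exists ws, euler_family H ws.

Definition connected H : Prop :=
  forall u v, u \in vset H -> v \in vset H ->
    exists w, [/\ is_walk H w, w.1 = u & walk_end w = v].

Definition no_empty_edges H : Prop := forall e, e \in eset H -> ends H e != set0.

Definition nonempty_hypergraph H : Prop := eset H != set0.

(** The edges of a subhypergraph on the vertex set V' are traces e :&: V' of
    edges e; they may be empty. *)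
Definition subhypergraph C H : Prop :=
  [/\ vset C \subset vset H, eset C \subset eset H
    & forall e, e \in eset C -> ends C e = ends H e :&: vset C].

Definition connected_component C H : Prop :=
  [/\ subhypergraph C H, connected C, no_empty_edges C
    & forall D, subhypergraph D H -> connected D -> no_empty_edges D ->
        subhypergraph C D -> D = C].

Definition cut_edges H S : {set L} :=
  [set e in eset H | (ends H e :&: S != set0)
                     && (ends H e :&: (vset H :\: S) != set0)].

Definition edge_cut H F : Prop :=
  exists S, [/\ S != set0, S \proper vset H & F = cut_edges H S].

Definition minimal_edge_cut H F : Prop :=
  edge_cut H F /\ forall F', edge_cut H F' -> ~~ (F' \proper F).

Section Deletion.
Variables (H : hypergraph T L) (F : {set L}).

Definition del_ends : {ffun L -> {set T}} :=
  [ffun e => if e \in F then set0 else ends H e].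

Fact del_ends_sub : [forall e, del_ends e \subset vset H].
Proof.
apply/forallP=> e; rewrite ffunE; case: ifP => _; first exact: sub0set.
exact: (forallP (ends_sub H)).
Qed.

Fact del_ends_out : [forall (e | e \notin eset H :\: F), del_ends e == set0].
Proof.
apply/forall_inP=> e; rewrite ffunE inE; case: ifP => // _ /= eH.
exact: (forall_inP (ends_out H)).
Qed.

Definition del_edges : hypergraph T L :=
  Hypergraph (vset_neq0 H) del_ends_sub del_ends_out.

End Deletion.
End Walks.

(** The unordered pair ij is the set [set i; j], of cardinality 1 when i = j. *)
Definition upair (I : finType) : Type := {A : {set I} | 0 < #|A| <= 2}.

Section EdgeCutAssignment.
Variables (T L I : finType) (H : hypergraph T L) (F : {set L}).
Variables (V : I -> {set T}) (alpha : {f : L | f \in F} -> upair I).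

Definition edge_cut_assignment : Prop :=
  forall (f : {f : L | f \in F}) (i j : I), val (alpha f) = [set i; j] ->
    (i != j -> (ends H (val f) :&: V i != set0)
               /\ (ends H (val f) :&: V j != set0))
    /\ (i = j -> 2 <= #|ends H (val f) :&: V i|).

Definition assigned_ends : {ffun L -> {set T}} :=
  [ffun e => if (insub e : option {f : L | f \in F}) is Some f
             then ends H e :&: \bigcup_(i in val (alpha f)) V i
             else ends H e].

Fact assigned_ends_sub : [forall e, assigned_ends e \subset vset H].
Proof.
apply/forallP=> e; have eH := forallP (ends_sub H) e.
by rewrite ffunE; case: insub => // f; apply: subset_trans eH; apply: subsetIl.
Qed.

Fact assigned_ends_out :
  [forall (e | e \notin eset H), assigned_ends e == set0].
Proof.
apply/forall_inP=> e eH; rewrite ffunE.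
have /eqP-> := forall_inP (ends_out H) e eH.
by case: insub => // f; rewrite set0I.
Qed.

Definition assigned_hypergraph : hypergraph T L :=
  Hypergraph (vset_neq0 H) assigned_ends_sub assigned_ends_out.

End EdgeCutAssignment.

Definition partition_family (T I : finType) (V : I -> {set T}) (D : {set T}) :
  Prop := injective V /\ partition [set V i | i : I] D.

Definition union_of_components (T L : finType) (A : {set T})
    (K : hypergraph T L) : Prop :=
  exists P : {set {set T}},
    (forall B, B \in P -> exists2 C, connected_component C K & vset C = B)
    /\ A = cover P.

(* Main.v *)
Require Import Defs.
From mathcomp Require Import all_boot.
Set Implicit Arguments.
Unset Strict Implicit.
Unset Printing Implicit Defensive.

(** An edge of the cut is traversed exactly once by an Euler tour or family of
    [H], and [alpha] records the classes of the two anchors around it; with this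
    choice every trail of the family is still a trail of [H^alpha].  Conversely,
    every trail of [H^alpha] is a trail of [H].  A closed trail stays inside one
    connected component, and an edge with at least one vertex lies in exactly one
    component, so Euler families of the components of [H^alpha] are the same
    thing as an Euler family of [H^alpha]. *)

Section Trails.
Variables T L : finType.
Implicit Types (H K : hypergraph T L) (w : walk T L) (ws : seq (walk T L)).

(** * Inclusions between hypergraphs and the transfer of walks and trails along them *)

Lemma ends_subset H e : ends H e \subset vset H.
Proof. exact: (forallP (ends_sub H) e). Qed.

Lemma ends_notin H e : e \notin eset H -> ends H e = set0.
Proof. by move=> eH; apply/eqP/(forall_inP (ends_out H)). Qed.

(** The remaining fields are proofs of boolean equations and hence unique. This yields the Leibniz
    equality that the maximality clause for components demands. *)
Lemma eq_hypergraph H K :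
  vset H = vset K -> eset H = eset K -> ends H =1 ends K -> H = K.
Proof.
case: H K => [V1 E1 f1 n1 s1 o1] [V2 E2 f2 n2 s2 o2] /= eV eE /ffunP ef.
case: V2 / eV n2 s2 => n2 s2; case: E2 / eE o2 => o2.
case: f2 / ef s2 o2 => s2 o2.
by congr Hypergraph; apply: eq_irrelevance.
Qed.

(** Weaker than [subhypergraph]: edges may shrink arbitrarily. It covers both a component inside [K]
    and [H^alpha] inside [H], and closed trails pass upwards along it. *)
Definition hsub H K : Prop :=
  [/\ vset H \subset vset K, eset H \subset eset K
    & forall e, ends H e \subset ends K e].

Lemma adjacent_via_hsub H K e u v :
  hsub H K -> adjacent_via H e u v -> adjacent_via K e u v.
Proof.
move=> [_ /subsetP sE sf] /and4P[eH uv ue ve]; apply/and4P; split=> //.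
- exact: sE.
- exact: (subsetP (sf e)).
- exact: (subsetP (sf e)).
Qed.

Lemma is_walk_from_hsub H K v s :
  hsub H K -> is_walk_from H v s -> is_walk_from K v s.
Proof.
move=> sHK; elim: s v => [|[e u] s IH] v /=; first by case: sHK => /subsetP + _ _; apply.
by case/andP=> /(adjacent_via_hsub sHK) -> /IH.
Qed.

Lemma closed_trail_hsub H K w : hsub H K -> closed_trail H w -> closed_trail K w.
Proof.
move=> sHK /andP[/and3P[wW cl sz] un]; rewrite /closed_trail /closed_walk cl sz un.
by rewrite /is_walk (is_walk_from_hsub sHK).
Qed.

Lemma hsub_subhypergraph H K : subhypergraph H K -> hsub H K.
Proof.
case=> sV sE sf; split=> // e; have [eH|eH] := boolP (e \in eset H).
  by rewrite sf // subsetIl.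
by rewrite (ends_notin eH) sub0set.
Qed.

Lemma is_walk_from_eset H v s :
  is_walk_from H v s -> {subset [seq p.1 | p <- s] <= eset H}.
Proof.
elim: s v => [|[e u] s IH] v //= /andP[/and4P[eH _ _ _] /IH sH] f.
by rewrite inE => /predU1P[->|/sH].
Qed.

Lemma is_walk_from_vset H v s :
  is_walk_from H v s -> {subset v :: [seq p.2 | p <- s] <= vset H}.
Proof.
elim: s v => [|[e u] s IH] v /=; first by move=> vH x; rewrite inE => /eqP->.
case/andP=> /and4P[_ _ vE _] /IH sH f; rewrite inE => /predU1P[->|/sH //].
exact: (subsetP (ends_subset H e)).
Qed.

Lemma closed_trail_eset H w : closed_trail H w -> {subset walk_edges w <= eset H}.
Proof. by case/andP=> /and3P[/is_walk_from_eset]. Qed.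

Lemma closed_trail_vset H w : closed_trail H w -> {subset anchors w <= vset H}.
Proof. by case/andP=> /and3P[/is_walk_from_vset]. Qed.

(** * Connectivity classes of vertices *)

Definition hadj K : rel T := fun u v => [exists e, adjacent_via K e u v].
(** This will be the vertex set of the component of [x]. For [x] outside [vset K] it is the
    singleton of [x]. *)
Definition hclass K x : {set T} := [set y | connect (hadj K) x y].

Lemma adjacent_via_hadj K e u v : adjacent_via K e u v -> hadj K u v.
Proof. by move=> a; apply/existsP; exists e. Qed.

Lemma hadj_sym K : symmetric (hadj K).
Proof.
by move=> u v; apply/existsP/existsP => -[e /and4P[? ? ? ?]]; exists e;
  apply/and4P; split; rewrite // eq_sym.
Qed.

Lemma hconnect_sym K : connect_sym (hadj K).
Proof. exact/sym_connect_sym/hadj_sym. Qed.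

Lemma hclass_refl K x : x \in hclass K x.
Proof. by rewrite inE connect0. Qed.

Lemma hclass_eq K x y : y \in hclass K x -> hclass K y = hclass K x.
Proof.
rewrite inE => xy; apply/setP=> z; rewrite !inE.
by rewrite (same_connect (hconnect_sym K) xy).
Qed.

Lemma hclass_sub K x : x \in vset K -> hclass K x \subset vset K.
Proof.
move=> xK; apply/subsetP=> y; rewrite inE => /connectP[p + ->].
elim: p x xK => //= z p IH x xK /andP[/existsP[e /and4P[_ _ _ ze]]].
by apply: IH; apply: (subsetP (ends_subset K e)).
Qed.

Lemma ends_hclass K e x y :
  x \in ends K e -> y \in ends K e -> y \in hclass K x.
Proof.
move=> xe ye; rewrite inE; have [->|xy] := eqVneq x y; first exact: connect0.
apply/connect1/(@adjacent_via_hadj _ e)/and4P; split=> //.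
by apply: contraLR xe => /ends_notin->; rewrite inE.
Qed.

Lemma is_walk_from_hclass K v s :
  is_walk_from K v s -> {subset v :: [seq p.2 | p <- s] <= hclass K v}.
Proof.
elim: s v => [|[e u] s IH] v /=.
  by move=> _ x; rewrite inE => /eqP->; apply: hclass_refl.
case/andP=> /adjacent_via_hadj /connect1 vu /IH sH x.
rewrite inE => /predU1P[->|/sH]; first exact: hclass_refl.
by rewrite (@hclass_eq _ v) // inE.
Qed.

Lemma connected_hclass K x : connected K -> x \in vset K -> hclass K x = vset K.
Proof.
move=> cK xK; apply/eqP; rewrite eqEsubset hclass_sub //; apply/subsetP=> y yK.
have [[v s] [/is_walk_from_hclass sw /= <- <-]] := cK _ _ xK yK.
by apply: sw; apply: mem_last.
Qed.

Lemma hclass_hsub H K x : hsub H K -> hclass H x \subset hclass K x.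
Proof.
move=> sHK; apply/subsetP=> y; rewrite !inE.
apply: connect_sub => u v /existsP[e a].
exact/connect1/(adjacent_via_hadj (adjacent_via_hsub sHK a)).
Qed.

(** * Construction of the connected component of a vertex *)

Section Component.
Variables (K : hypergraph T L) (x : T).
Hypothesis xK : x \in vset K.

(** Requiring a non-empty trace discards empty edges, which a component must not have. *)
Definition comp_eset := [set e in eset K | ends K e :&: hclass K x != set0].
Definition comp_ends : {ffun L -> {set T}} := [ffun e => ends K e :&: hclass K x].

Fact comp_vset_neq0 : hclass K x != set0.
Proof. by apply/set0Pn; exists x; apply: hclass_refl. Qed.

Fact comp_ends_sub : [forall e, comp_ends e \subset hclass K x].
Proof. by apply/forallP=> e; rewrite ffunE subsetIr. Qed.

Fact comp_ends_out : [forall (e | e \notin comp_eset), comp_ends e == set0].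
Proof.
apply/forall_inP=> e; rewrite ffunE inE negb_and negbK => /orP[|//].
by move/ends_notin->; rewrite set0I.
Qed.

Definition comp : hypergraph T L :=
  Hypergraph comp_vset_neq0 comp_ends_sub comp_ends_out.

Lemma comp_sub : subhypergraph comp K.
Proof.
split=> /=; first exact: hclass_sub.
  by apply/subsetP=> e; rewrite inE => /andP[].
by move=> e _; rewrite ffunE.
Qed.

(** A walk that starts in a class never leaves it, so every edge it uses meets the class and keeps
    both anchors in its trace. *)
Lemma comp_is_walk_from v s :
  v \in hclass K x -> is_walk_from K v s -> is_walk_from comp v s.
Proof.
elim: s v => [|[e u] s IH] v //= vx /andP[a].
have ux : u \in hclass K x.
  by rewrite -(hclass_eq vx) inE; apply/connect1/(adjacent_via_hadj a).
move/(IH _ ux) ->; rewrite andbT.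
case/and4P: a => eK uv ve ue; rewrite /adjacent_via uv /= ffunE !inE.
rewrite ve ue eK /= !inE in vx ux *; rewrite vx ux !andbT.
by apply/set0Pn; exists v; rewrite !inE ve.
Qed.

Lemma comp_closed_trail w :
  w.1 \in hclass K x -> closed_trail K w -> closed_trail comp w.
Proof.
move=> wx /andP[/and3P[wW cl sz] un]; rewrite /closed_trail /closed_walk cl sz un.
by rewrite /is_walk comp_is_walk_from.
Qed.

Lemma comp_connected : connected comp.
Proof.
move=> u v /= ux vx; have : v \in hclass K u by rewrite (hclass_eq ux).
rewrite inE => /connectP[p + ->] {vx}.
elim: p u ux => [|z p IH] u ux /=; first by exists (u, [::]).
case/andP=> uz /(IH z).
have zx : z \in hclass K x by rewrite -(hclass_eq ux) inE; apply: connect1.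
case=> // -[z' s] [/= wW zz' ez]; rewrite {z'}zz' in wW ez.
case/existsP: uz => e a; exists (u, (e, z) :: s); split=> //.
apply: comp_is_walk_from => //=; rewrite a.
exact: (is_walk_from_hsub (hsub_subhypergraph comp_sub)).
Qed.

Lemma comp_no_empty : no_empty_edges comp.
Proof. by move=> e; rewrite inE ffunE => /andP[]. Qed.

(** Connectedness puts [vset D] inside the class of [x]; each edge of [D] is non-empty, so it meets
    the class and is an edge of [comp]. *)
Lemma comp_max D :
    subhypergraph D K -> connected D -> no_empty_edges D -> x \in vset D ->
  subhypergraph D comp.
Proof.
move=> sD cD nD xD; have sV : vset D \subset hclass K x.
  by rewrite -(connected_hclass cD xD) hclass_hsub //; apply: hsub_subhypergraph.
case: sD => _ sE sf; split=> // [|e eD].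
  apply/subsetP=> e eD; rewrite inE (subsetP sE) //=.
  have /set0Pn[y] := nD _ eD; rewrite sf // inE => /andP[ye yD].
  by apply/set0Pn; exists y; rewrite inE ye (subsetP sV).
by rewrite sf //= ffunE -setIA (setIidPr sV).
Qed.

Lemma subhypergraph_antisym H1 H2 :
  subhypergraph H1 H2 -> subhypergraph H2 H1 -> H1 = H2.
Proof.
move=> [v1 e1 f1] [v2 e2 f2].
have eE : eset H1 = eset H2 by apply/eqP; rewrite eqEsubset e1.
have eV : vset H1 = vset H2 by apply/eqP; rewrite eqEsubset v1.
apply: eq_hypergraph => // e; have [eH|eH] := boolP (e \in eset H1).
  by rewrite f1 // eV; apply/setIidPl/ends_subset.
by rewrite !ends_notin // -eE.
Qed.

Lemma compP : connected_component comp K.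
Proof.
split; [exact: comp_sub|exact: comp_connected|exact: comp_no_empty|].
move=> D sD cD nD sCD; apply: subhypergraph_antisym => //.
by apply: comp_max => //; case: sCD => /subsetP + _ _; apply; apply: hclass_refl.
Qed.

Lemma comp_uniq C : connected_component C K -> x \in vset C -> C = comp.
Proof.
case=> sC cC nC mC xC; apply/esym/mC.
- exact: comp_sub.
- exact: comp_connected.
- exact: comp_no_empty.
- exact: comp_max.
Qed.

End Component.

(** * Uniqueness of the component of a vertex or of an edge *)

Lemma component_uniq K C D x :
    connected_component C K -> connected_component D K ->
  x \in vset C -> x \in vset D -> C = D.
Proof.
move=> cC cD xC xD; have xK : x \in vset K by case: cC => -[/subsetP + _ _] _ _ _; apply.
by rewrite (comp_uniq xK cC xC) (comp_uniq xK cD xD).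
Qed.

Lemma component_vset K C x :
  connected_component C K -> x \in vset C -> vset C = hclass K x.
Proof.
move=> cC xC; have xK : x \in vset K by case: cC => -[/subsetP + _ _] _ _ _; apply.
by rewrite (comp_uniq xK cC xC).
Qed.

(** Two vertices of one edge are equal or adjacent, so an edge that meets a class is contained in it
    and its trace is the whole edge. *)
Lemma component_ends K C e :
  connected_component C K -> e \in eset C -> ends C e = ends K e.
Proof.
move=> cC eC; have [[_ _ sf] _ nC _] := cC.
have /set0Pn[x] := nC _ eC; rewrite sf // inE => /andP[xe xC].
apply/setIidPl/subsetP=> y ye; rewrite (component_vset cC xC).
exact: ends_hclass ye.
Qed.

Lemma component_eset K C e x :
    connected_component C K -> x \in ends K e -> x \in vset C ->
  e \in eset C.
Proof.
move=> cC xe xC; have xK := subsetP (ends_subset K e) _ xe.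
rewrite (comp_uniq xK cC xC) inE; apply/andP; split.
  by apply: contraLR xe => /ends_notin->; rewrite inE.
by apply/set0Pn; exists x; rewrite inE xe hclass_refl.
Qed.

Lemma component_edge_uniq K C D e :
    connected_component C K -> connected_component D K ->
  e \in eset C -> e \in eset D -> C = D.
Proof.
move=> cC cD eC eD; have [_ _ nC _] := cC; have /set0Pn[x xe] := nC _ eC.
apply: (component_uniq (x := x) cC cD).
  exact: (subsetP (ends_subset C e)).
apply: (subsetP (ends_subset D e)).
by rewrite (component_ends cD eD) -(component_ends cC eC).
Qed.

(** * Closed trails and Euler families restricted to a component *)

Lemma closed_trail_edge_ends K w e :
  closed_trail K w -> e \in walk_edges w ->
  exists2 x, x \in anchors w & x \in ends K e.
Proof.
case: w => v s /andP[/and3P[+ _ _] _]; rewrite /is_walk /anchors /walk_edges /=.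
elim: s v => [|[f u] s IH] v //= /andP[/and4P[_ _ ve _] wW].
rewrite inE => /predU1P[->|es]; first by exists v; rewrite ?mem_head.
by have [x xs xe] := IH _ wW es; exists x => //; rewrite inE xs orbT.
Qed.

Lemma closed_trail_component K C w :
  connected_component C K -> w.1 \in vset C -> closed_trail K w ->
  closed_trail C w.
Proof.
move=> cC wC tw; have wK : w.1 \in vset K by apply: (closed_trail_vset tw); apply: mem_head.
by rewrite (comp_uniq wK cC wC); apply: comp_closed_trail => //; apply: hclass_refl.
Qed.

(** A traversed edge contains an anchor of [w]. As the edge belongs to [C], so does this anchor, and
    with it the whole trail. *)
Lemma closed_trail_edge_component K C w e :
    connected_component C K -> closed_trail K w ->
  e \in eset C -> e \in walk_edges w -> closed_trail C w.
Proof.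
move=> cC tw eC ew; apply: (closed_trail_component cC) => //.
have [x xw xe] := closed_trail_edge_ends tw ew.
have xC : x \in vset C.
  by apply: (subsetP (ends_subset C e)); rewrite (component_ends cC eC).
have /andP[/and3P[/is_walk_from_hclass sw _ _] _] := tw.
by rewrite (component_vset cC xC) (hclass_eq (sw _ xw)); apply: hclass_refl.
Qed.

Lemma euler_family_component K C ws :
  connected_component C K -> euler_family K ws ->
  euler_family C [seq w <- ws | closed_trail C w].
Proof.
move=> cC [tws dws cov]; split.
- exact: filter_all.
- exact: pairwise_filter.
- move=> e eC; have eK : e \in eset K by case: cC => -[_ /subsetP + _] _ _ _; apply.
  have [w ww ew] := cov e eK; exists w => //; rewrite mem_filter ww andbT.
  exact: (closed_trail_edge_component cC (allP tws w ww) eC ew).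
Qed.

(** * Gluing Euler families of the components *)

Lemma pairwise_flatten (A B : eqType) (r : rel B) (f : A -> seq B) (s : seq A) :
    uniq s -> (forall x, x \in s -> pairwise r (f x)) ->
    (forall x y u v, x \in s -> y \in s -> x != y -> u \in f x -> v \in f y -> r u v) ->
  pairwise r (flatten [seq f x | x <- s]).
Proof.
elim: s => //= a s IH /andP[aNs us] pf df; rewrite pairwise_cat pf ?mem_head //=.
apply/andP; split.
  apply/allrelP=> u v ua /flatten_mapP[y ys vy].
  apply: (df a y) => //; rewrite ?mem_head ?inE ?ys ?orbT //.
  by apply: contraNneq aNs => ->.
by apply: IH => // [x xs|x y u v xs ys]; [apply: pf|apply: df];
  rewrite inE ?xs ?ys orbT.
Qed.

Lemma components_euler_family K :
    no_empty_edges K ->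
    (forall C, connected_component C K -> has_euler_family C) ->
  has_euler_family K.
Proof.
move=> nK efC.
(* One family is chosen for each vertex; the implication lets vertices outside [vset K] take the
   empty list as a default. *)
have /fin_all_exists[f fP] (x : T) : exists ws, x \in vset K ->
    exists C, [/\ connected_component C K, x \in vset C & euler_family C ws].
  have [xK|_] := boolP (x \in vset K); last by exists [::].
  have [ws wsP] := efC _ (compP xK).
  by exists ws => _; exists (comp K x); split=> //; [apply: compP|apply: hclass_refl].
(* Each class contributes one representative, its canonical [root], so distinct members of [r] lie
   in distinct components. *)
pose r := [seq x <- enum (vset K) | root (hadj K) x == x].
have rP x : x \in r -> x \in vset K /\ root (hadj K) x = x.
  by rewrite mem_filter mem_enum => /andP[/eqP].
exists (flatten [seq f x | x <- r]); split.
- apply/allP=> w /flatten_mapP[x /rP[xK _] wx].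
  have [C [[sC _ _ _] _ [/allP tC _ _]]] := fP x xK.
  exact: (closed_trail_hsub (hsub_subhypergraph sC) (tC w wx)).
- apply: pairwise_flatten => [|x /rP[xK _]|x y u v].
  + by rewrite filter_uniq ?enum_uniq.
  + by have [C [_ _ []]] := fP x xK.
  move=> /rP[xK rx] /rP[yK ry] xy ux vy.
  have [C [cC xC [/allP tC _ _]]] := fP x xK.
  have [D [cD yD [/allP tD _ _]]] := fP y yK.
  have CD : C <> D.
    move=> eCD; move: yD; rewrite -eCD (component_vset cC xC) inE => cxy.
    by case/eqP: xy; rewrite -rx -ry; apply/eqP; rewrite root_connect //; apply: hconnect_sym.
  apply/andP; split; apply/hasPn=> e ev; apply/negP=> /= eu; apply: CD.
  + by apply: (component_edge_uniq cC cD (e := e));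
      [apply: (closed_trail_eset (tC u ux))|apply: (closed_trail_eset (tD v vy))].
  + by apply: (component_uniq (x := e) cC cD);
      [apply: (closed_trail_vset (tC u ux))|apply: (closed_trail_vset (tD v vy))].
- move=> e eK; have /set0Pn[y ye] := nK e eK.
  have yK := subsetP (ends_subset K e) _ ye.
  pose x := root (hadj K) y.
  have yx : y \in hclass K x by rewrite inE hconnect_sym; apply: connect_root.
  have xy : x \in hclass K y by rewrite inE; apply: connect_root.
  have xK := subsetP (hclass_sub yK) _ xy.
  have [C [cC xC [_ _ cov]]] := fP x xK.
  have [|w wx ew] := cov e.
    by apply: (component_eset (x := y) cC) => //; rewrite (component_vset cC xC).
  exists w => //; apply/flatten_mapP; exists x => //.
  by rewrite mem_filter mem_enum xK andbT root_root //; apply: hconnect_sym.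
Qed.

(** * Trails as lists of oriented steps, each an edge with the two anchors around it *)

Fixpoint steps (v : T) (s : seq (L * T)) : seq (L * (T * T)) :=
  if s is (e, u) :: s' then (e, (v, u)) :: steps u s' else [::].

Lemma map_fst_steps v s : [seq p.1 | p <- steps v s] = [seq p.1 | p <- s].
Proof. by elim: s v => [|[e u] s IH] v //=; rewrite IH. Qed.

(** Being a walk becomes a condition on single steps, so passing from [H] to [H^alpha] only requires
    rechecking each step separately. *)
Lemma is_walk_from_steps H v s :
  is_walk_from H v s =
  (last v [seq p.2 | p <- s] \in vset H) &&
    all (fun p => adjacent_via H p.1 p.2.1 p.2.2) (steps v s).
Proof.
elim: s v => [|[e u] s IH] v //=; first by rewrite andbT.
by rewrite IH andbCA.
Qed.

Lemma flatten_steps_edges ws :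
  [seq p.1 | p <- flatten [seq steps w.1 w.2 | w <- ws]] =
  flatten [seq walk_edges w | w <- ws].
Proof. by elim: ws => //= w ws IH; rewrite map_cat map_fst_steps IH. Qed.

Lemma uniq_fst_inj (A B : eqType) (s : seq (A * B)) a b c :
  uniq [seq p.1 | p <- s] -> (a, b) \in s -> (a, c) \in s -> b = c.
Proof.
elim: s => //= -[a' b'] s IH /andP[aNs us]; rewrite !inE.
have sN d : (a', d) \in s -> False.
  by move=> ds; case/negP: aNs; apply/mapP; exists (a', d).
case/predU1P=> [[-> ->]|bs] /predU1P[].
- by case.
- by move/sN.
- by case=> ea _; rewrite ea in bs; case: (sN _ bs).
- exact: IH.
Qed.

Lemma uniq_family_edges H ws :
    all (closed_trail H) ws -> pairwise (@edge_disjoint T L) ws ->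
  uniq (flatten [seq walk_edges w | w <- ws]).
Proof.
elim: ws => //= w ws IH /andP[/andP[_ uw] tws] /andP[/allP dw dws].
rewrite cat_uniq uw IH // andbT /=; apply/hasPn=> e /flatten_mapP[w' ws' ew'].
exact: (hasPn (dw _ ws')).
Qed.

End Trails.

(** * Edge cut assignments and the assignment read off from a system of trails *)

Section Assignment.
Variables (T L I : finType) (H : hypergraph T L) (F : {set L}) (V : I -> {set T}).
Implicit Types (alpha : {f : L | f \in F} -> upair I).

Lemma hsub_assigned alpha : hsub (assigned_hypergraph H V alpha) H.
Proof.
split=> //= e; rewrite ffunE; case: insub => // f; exact: subsetIl.
Qed.

Lemma assigned_no_empty alpha :
    no_empty_edges H -> edge_cut_assignment H V alpha ->
  no_empty_edges (assigned_hypergraph H V alpha).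
Proof.
move=> nH aP e /= eH; rewrite ffunE; case: insubP => [f _ <-|_]; last exact: nH.
have [i [j ij]] : exists i j, val (alpha f) = [set i; j].
  case: (alpha f) => A /= /andP[A0 A2]; case: (ltngtP #|A| 1) => cA.
  - by move: A0; rewrite lt0n -leqn0 -ltnS cA.
  - have /cards2P[i [j [_ ->]]] : #|A| == 2 by rewrite eqn_leq A2.
    by exists i, j.
  - by have /cards1P[i ->] : #|A| == 1 by [rewrite cA]; exists i, i; rewrite setUid.
(* Whether or not the two indices coincide, the edge meets [V i], and that part survives in the
   trimmed edge. *)
have : ends H (val f) :&: V i != set0.
  have [neq eqq] := aP f i j ij; have [/eqq|/neq[]//] := eqVneq i j.
  by rewrite -card_gt0 => /ltnW.
case/set0Pn=> x /setIP[xf xi]; apply/set0Pn; exists x; rewrite inE xf.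
by apply/bigcupP; exists i => //; rewrite ij !inE eqxx.
Qed.

Lemma upair_subproof (i j : I) : 0 < #|[set i; j]| <= 2.
Proof. by rewrite cards2; case: eqP. Qed.

Definition mk_upair (i j : I) : upair I :=
  exist (fun A : {set I} => 0 < #|A| <= 2) [set i; j] (upair_subproof i j).

(** Each cut edge is sent to the classes of the two anchors around its single traversal. Working
    with a list of trails serves Euler families and, through a one-element list, Euler tours. *)
Lemma assignment_of_trails (ws : seq (walk T L)) :
    F \subset eset H -> partition_family V (vset H) ->
    all (closed_trail H) ws -> uniq (flatten [seq walk_edges w | w <- ws]) ->
    (forall e, e \in eset H -> exists2 w, w \in ws & e \in walk_edges w) ->
  exists alpha, edge_cut_assignment H V alpha /\
    all (closed_trail (assigned_hypergraph H V alpha)) ws.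
Proof.
move=> sF [_ pV] tws uws cov.
pose st := flatten [seq steps w.1 w.2 | w <- ws].
have st_adj p : p \in st -> adjacent_via H p.1 p.2.1 p.2.2.
  case/flatten_mapP=> w /(allP tws) /andP[/and3P[+ _ _] _].
  by rewrite /is_walk is_walk_from_steps => /andP[_ /allP/(_ p)].
have classP x : x \in vset H -> exists i, x \in V i.
  case/and3P: pV => /eqP <- _ _ /bigcupP[A /imsetP[i _ ->] xi]; by exists i.
(* For each cut edge [f], [c f] records the two anchors of a step along [f], followed by the indices
   of their classes. *)
have /fin_all_exists[c cP] (f : {f : L | f \in F}) : exists c : (T * T) * (I * I),
    [/\ (val f, c.1) \in st, c.1.1 \in V c.2.1 & c.1.2 \in V c.2.2].
  have fH := subsetP sF _ (valP f); have [w ww fw] := cov _ fH.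
  have : val f \in [seq p.1 | p <- st].
    by rewrite flatten_steps_edges; apply/flatten_mapP; exists w.
  case/mapP=> -[e [u v]] ust /= ef; rewrite {1}ef.
  have /and4P[_ _ /= ue ve] := st_adj _ ust.
  have [i ui] := classP _ (subsetP (ends_subset H e) _ ue).
  have [j vj] := classP _ (subsetP (ends_subset H e) _ ve).
  by exists ((u, v), (i, j)).
pose alpha f := mk_upair (c f).2.1 (c f).2.2.
exists alpha; split=> [f i j /= eij|].
  have [/st_adj /and4P[/= _ uv uf vf] ui vj] := cP f.
  (* Equality of unordered pairs fixes no order, so [i] and [j] are treated alike: each is one of
     the two recorded indices. *)
  have ne k : k \in [set i; j] -> ends H (val f) :&: V k != set0.
    by rewrite -eij !inE => /orP[]/eqP->; apply/set0Pn;
      [exists (c f).1.1|exists (c f).1.2]; rewrite inE ?uf ?vf.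
  split=> [_|ij]; first by rewrite !ne // !inE eqxx ?orbT.
  (* Both anchors now lie in [V i], and adjacency makes them distinct, which gives the two required
     vertices. *)
  move: eij; rewrite -{}ij setUid => eij.
  have /set1P i1 : (c f).2.1 \in [set i] by rewrite -eij !inE eqxx.
  have /set1P i2 : (c f).2.2 \in [set i] by rewrite -eij !inE eqxx orbT.
  rewrite i1 in ui; rewrite i2 in vj.
  have -> : 2 = #|[set (c f).1.1; (c f).1.2]| by rewrite cards2 uv.
  by apply/subset_leq_card/subsetP=> x; rewrite !inE => /orP[]/eqP->;
    rewrite ?uf ?vf.
apply/allP=> w ww; have /andP[/and3P[wW cl sz] un] := allP tws w ww.
rewrite /closed_trail /closed_walk cl sz un /= !andbT.
move: wW; rewrite /is_walk !is_walk_from_steps /= => /andP[-> aH] /=.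
apply/allP=> -[e [u v]] pw; have /and4P[/= eH uv ue ve] := allP aH _ pw.
rewrite /adjacent_via /= eH uv /= ffunE; case: insubP => [f _ fe|_]; last by rewrite ue.
have [cst ui vj] := cP f.
have est : (e, (u, v)) \in st by apply/flatten_mapP; exists w.
(* No edge is traversed twice, so this step is the one from which [alpha f] was read off; hence both
   anchors lie in the classes kept by the trimming. *)
have cuv : (c f).1 = (u, v).
  by apply: (@uniq_fst_inj _ _ st e) => //; rewrite ?flatten_steps_edges // -fe.
rewrite cuv /= in ui vj; rewrite !inE ue ve /=.
by apply/andP; split; apply/bigcupP; [exists (c f).2.1|exists (c f).2.2];
  rewrite //= !inE eqxx ?orbT.
Qed.

End Assignment.

Theorem theorem4p4 (T L I : finType) (H : hypergraph T L) (F : {set L})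
    (V : I -> {set T})
    (Hne : no_empty_edges H)
    (Hconn : connected H)
    (HF : minimal_edge_cut H F)
    (HV : partition_family V (vset H))
    (HVF : forall i : I, union_of_components (V i) (del_edges H F)) :
  (has_euler_family H <->
     exists alpha : {f : L | f \in F} -> upair I,
       edge_cut_assignment H V alpha
       /\ forall C : hypergraph T L,
            connected_component C (assigned_hypergraph H V alpha) ->
            has_euler_family C)
  /\
  (has_euler_tour H <->
     exists alpha : {f : L | f \in F} -> upair I,
       edge_cut_assignment H V alpha
       /\ exists C : hypergraph T L,
            (connected_component C (assigned_hypergraph H V alpha)
             /\ nonempty_hypergraph C)
            /\ (forall C' : hypergraph T L,
                  connected_component C' (assigned_hypergraph H V alpha)
                  /\ nonempty_hypergraph C' -> C' = C)
            /\ has_euler_tour C).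
Proof.
have sF : F \subset eset H.
  have [[S [_ _ ->]] _] := HF.
  by apply/subsetP=> e; rewrite inE => /andP[].
split; split.
- case=> ws [tws dws cov].
  have [|alpha [aP tK]] := assignment_of_trails sF HV tws _ cov.
  + by apply: (uniq_family_edges tws); apply: sub_pairwise dws => w w' /andP[].
  exists alpha; split=> // C cC.
  by eexists; apply: (euler_family_component cC (ws := ws)); split.
- case=> alpha [aP efC].
  have [ws [tws dws cov]] := components_euler_family (assigned_no_empty Hne aP) efC.
  (* [H^alpha] and [H] have the same edge labels, so disjointness and covering carry over unchanged;
     only the trails need transfer. *)
  exists ws; split=> //; apply: sub_all tws => w.
  exact/closed_trail_hsub/hsub_assigned.
- case=> w [tw cov].
  have [||e eH|alpha [aP]] := @assignment_of_trails _ _ _ H F V [:: w] sF HV.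
  + by rewrite /= tw.
  + by rewrite /= cats0; case/andP: tw.
  + by exists w; rewrite ?mem_head ?cov.
  rewrite /= andbT => tK; set K := assigned_hypergraph H V alpha in tK.
  have wK : w.1 \in vset K by apply: (closed_trail_vset tK); apply: mem_head.
  have cC := compP wK; have tC := comp_closed_trail (hclass_refl K w.1) tK.
  exists alpha; split=> //; exists (comp K w.1).
  split; [split=> //|split].
  (* A closed trail has at least two steps, and its first edge witnesses non-emptiness. *)
  + move: tC => /[dup] /closed_trail_eset sC /andP[/and3P[_ _]].
    rewrite /walk_edges in sC; case: w.2 sC => // -[e u] s sC _ _.
    by apply/set0Pn; exists e; apply: sC; apply: mem_head.
  (* An edge of any other non-empty component also lies on [w], hence in the component of [w.1], and
     an edge belongs to at most one component. *)
  + move=> D [cD /set0Pn[e eD]]; apply: (component_edge_uniq cD cC eD).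
    apply: (closed_trail_eset tC); apply: cov.
    by case: cD => -[_ /subsetP + _] _ _ _; apply.
  + exists w; split=> // e eC; apply: cov.
    by case: cC => -[_ /subsetP + _] _ _ _; apply.
- case=> alpha [aP [C [[cC _] [uC [w [tw cov]]]]]].
  set K := assigned_hypergraph H V alpha in cC uC.
  exists w; split=> [|e eH].
    apply: (closed_trail_hsub (hsub_assigned _ _ alpha)).
    by case: cC => /hsub_subhypergraph sC _ _ _; apply: (closed_trail_hsub sC).
  (* The trimmed edge still has a vertex [x]. The component of [x] contains [e], so it is non-empty
     and must be [C]. *)
  apply: cov; have /set0Pn[x xe] := assigned_no_empty Hne aP eH.
  have xK := subsetP (ends_subset K e) _ xe; have cD := compP xK.
  have eD := component_eset cD xe (hclass_refl K x).
  by rewrite -(uC (comp K x)) //; split=> //; apply/set0Pn; exists e.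
Qed.
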